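(* Let $F(p)=\#\{u\in\{0,\ldots,p-1\}:\ q_p(u)=u\}$. Then $F(p)\le p^{11/12+o(1)}$ as $p\to\infty$ over primes $p$.
   Context: For a prime $p$ and an integer $u$ with $\gcd(u,p)=1$, the Fermat quotient $q_p(u)$ is the unique integer with $q_p(u)\equiv (u^{p-1}-1)/p \pmod p$ and $0\le q_p(u)\le p-1$; also $q_p(kp)=0$ for all $k\in\mathbb{Z}$. *)

(* Defs.v *)
From mathcomp Require Import all_boot.

(* Fermat quotient q_p(u) for naturals u (enough: only u in {0..p-1} is used).
   If p | u then q_p(u) = 0; otherwise (p prime, gcd(u,p)=1) p divides
   u^(p-1) - 1 (Fermat), so the division below is exact and the value is the
   least residue in [0,p-1] of (u^(p-1)-1)/p mod p. *)
Definition fermat_quotient (p u : nat) : nat :=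
  if p %| u then 0 else ((u ^ (p - 1) - 1) %/ p) %% p.

Definition F (p : nat) : nat :=
  count (fun u => fermat_quotient p u == u) (iota 0 p).

(* Main.v *)
(* Cut [0, p) into blocks of length N ~ p^(11/12). In a block [M, M + N) a fixed
   point u has q(u) in the same short interval, so it suffices to bound, for an
   interval J of length N, the number of u in the block with q(u) in J.  This is
   Burgess' method for the modulus p^2 with fourth moments.  Every u is written
   n + ab in AB ways, with 1 <= a <= A, 0 <= b < B ~ p^(1/2), AB <= N, and
   q(n + ab) = q(a) + q(x + b) with x = n/a mod p^2.  Cauchy-Schwarz reduces the
   problem to the number of coincidences n/a = n'/a', which are integer equations
   n a' = n' a because all terms are below p^2, and to a fourth moment over
   x = y + pz.  As q(y + pz + b) = q(y + b) - z/(y + b), summing over z kills all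
   terms except those with 1/(y+b1) - 1/(y+b2) - 1/(y+b3) + 1/(y+b4) = 0, which has
   at most two solutions y unless the b's cancel in pairs.  Exponential sums are
   avoided: the role of the characters is played by the function 1_J - N/p, of
   mean zero, and its autocorrelation. *)

Require Import Defs.
From mathcomp Require Import all_boot all_order all_algebra cyclic.
From mathcomp Require zify ring lra.

Set Implicit Arguments.
Unset Strict Implicit.
Unset Printing Implicit Defensive.

Module FixedPoints.

Import zify ring lra.
Import Order.TTheory GRing.Theory Num.Theory.

Local Open Scope ring_scope.

(** * Cauchy-Schwarz and autocorrelations on a finite field *)

Lemma sum_cauchy_schwarz (R : realFieldType) (I : finType) (f g : I -> R) :
  (\sum_i f i * g i) ^+ 2 <= (\sum_i f i ^+ 2) * (\sum_i g i ^+ 2).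
Proof.
(* Lagrange's identity: this double sum is twice the difference of the two sides. *)
have h : 0 <= \sum_i \sum_j (f i * g j - f j * g i) ^+ 2.
  by apply: sumr_ge0 => i _; apply: sumr_ge0 => j _; apply: sqr_ge0.
have e : \sum_i \sum_j (f i * g j - f j * g i) ^+ 2 =
    (\sum_i f i ^+ 2) * (\sum_i g i ^+ 2) * 2 - (\sum_i f i * g i) ^+ 2 * 2.
  transitivity (\sum_i \sum_j (f i ^+ 2 * g j ^+ 2) +
      \sum_i \sum_j (g i ^+ 2 * f j ^+ 2) +
      (- 2) * (\sum_i \sum_j ((f i * g i) * (f j * g j)))).
    rewrite mulr_sumr -!big_split; apply: eq_bigr => i _ /=.
    rewrite mulr_sumr -!big_split; apply: eq_bigr => j _ /=; ring.
  by rewrite -!big_distrlr /=; ring.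
rewrite e in h; lra.
Qed.

Lemma sum_comp_inj (V : nmodType) (T : finType) (h : T -> T) (G : T -> V) :
  injective h -> \sum_i G (h i) = \sum_i G i.
Proof. by move=> h_inj; rewrite [RHS](reindex_inj h_inj). Qed.

Section Autocorrelation.

Variables (R : realFieldType) (K : finFieldType) (g : K -> R).

Definition autocorr (t : K) : R := \sum_s g (s + t) * g s.

Lemma autocorr_shift (c d : K) :
  \sum_s g (s + c) * g (s + d) = autocorr (c - d).
Proof.
rewrite (reindex_inj (addIr (- d))) /=; apply: eq_bigr => s _.
by rewrite subrK; congr (g _ * _); ring.
Qed.

Lemma autocorr_reflect (c d : K) :
  \sum_s g (c - s) * g (d - s) = autocorr (c - d).
Proof.
rewrite (reindex_inj (inj_comp (addrI d) (@oppr_inj _))) /=.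
by apply: eq_bigr => s _; congr (g _ * g _); ring.
Qed.

Lemma autocorr_le (t : K) : autocorr t <= \sum_s g s ^+ 2.
Proof.
have e : \sum_s g s ^+ 2 = (\sum_s (g (s + t) ^+ 2 + g s ^+ 2)) / 2.
  by rewrite big_split /= (sum_comp_inj (fun s => g s ^+ 2) (addIr t)); field.
rewrite e ler_pdivlMr // mulr_suml; apply: ler_sum => s _.
have := sqr_ge0 (g (s + t) - g s); nra.
Qed.

(** For fixed [s] the argument runs once through [K] as [z] does, so the sum over [z] is the full
    sum of [g]. *)
Lemma sum_autocorr_affine (c d : K) :
  \sum_s g s = 0 -> d != 0 -> \sum_z autocorr (c - z * d) = 0.
Proof.
move=> g0 d0; rewrite exchange_big big1 //= => s _.
have inj : injective (fun z => s + (c - z * d)).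
  by move=> z z' /addrI /addrI /oppr_inj; exact: mulIf.
by rewrite -mulr_suml (sum_comp_inj g inj) g0 mul0r.
Qed.

(** Opening the square gives autocorrelations over pairs [b], with a factor [g s] common to all
    pairs. Cauchy-Schwarz in [s] removes it, and squaring the other factor brings in the second pair
    [b']. *)
Lemma energy_sqr_le (J : finType) (U : pred J) (q : J -> K) :
  (\sum_s (\sum_(b | U b) g (q b - s)) ^+ 2) ^+ 2 <=
  (\sum_s g s ^+ 2) *
  (\sum_(b : J * J | U b.1 && U b.2) \sum_(b' : J * J | U b'.1 && U b'.2)
     autocorr ((q b.1 - q b.2) - (q b'.1 - q b'.2))).
Proof.
have -> : \sum_s (\sum_(b | U b) g (q b - s)) ^+ 2 =
    \sum_s g s * \sum_(b : J * J | U b.1 && U b.2) g (s + (q b.1 - q b.2)).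
  under [RHS]eq_bigr do rewrite mulr_sumr.
  rewrite [RHS]exchange_big /=.
  under eq_bigr do rewrite expr2 big_distrlr pair_big /=.
  rewrite exchange_big /=; apply: eq_bigr => b _.
  by rewrite autocorr_reflect /autocorr; apply: eq_bigr => s _; rewrite mulrC.
apply: (le_trans (sum_cauchy_schwarz _ _)).
rewrite ler_wpM2l ?sumr_ge0 // => [s _|]; first exact: sqr_ge0.
under eq_bigr do rewrite expr2 big_distrlr /=.
rewrite exchange_big /=; apply: ler_sum => b _.
rewrite exchange_big /=; apply: ler_sum => b' _.
by rewrite autocorr_shift.
Qed.

End Autocorrelation.

(** * The reciprocal equation and the fourth moment *)

Section ReciprocalEquation.

Variables (K : finFieldType) (J : finType) (beta : J -> K).
Hypotheses (char2 : 2%:R != 0 :> K) (beta_inj : injective beta).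

(** The coefficient of [- z] when the values [c y b - z / (y + beta b)] at the four indices are
    combined with these signs. *)
Definition recip_defect (y : K) (b b' : J * J) : K :=
  ((y + beta b.1)^-1 - (y + beta b.2)^-1) -
  ((y + beta b'.1)^-1 - (y + beta b'.2)^-1).

Definition recip_ok (y : K) (b : J * J) :=
  (y + beta b.1 != 0) && (y + beta b.2 != 0).

Definition recip_trivial (b b' : J * J) :=
  (b.1 == b.2) && (b'.1 == b'.2) || (b == b').

(* Clearing denominators leaves a polynomial of degree at most 2 in [y], whose
   coefficients vanish only if [{b.1, b'.2} = {b.2, b'.1}]. *)
Lemma card_recip_defect_eq0 (b b' : J * J) : ~~ recip_trivial b b' ->
  (#|[set y | [&& recip_ok y b, recip_ok y b' & recip_defect y b b' == 0%R]]| <= 2)%N.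
Proof.
case: b b' => [b1 b2] [b3 b4] nt.
pose x1 := beta b1; pose x2 := beta b2; pose x3 := beta b3; pose x4 := beta b4.
pose e2 := (x2 + x3) - (x1 + x4); pose e1 := x2 * x3 - x1 * x4.
pose e0 := (x1 + x4) * (x2 * x3) - (x2 + x3) * (x1 * x4).
pose P := Poly [:: e0; 2%:R * e1; e2].
have P0 : P != 0.
  apply: contraNneq nt => /(congr1 (fun p : {poly K} => (p`_1, p`_2))).
  rewrite !coef_Poly !coef0 /= => -[/eqP]; rewrite mulf_eq0 (negPf char2) /=.
  move=> /eqP E1 E2.
  (* As [e1] and [e2] vanish, [x1] and [x4] have the sum and product of [x2] and [x3], so [x1] is a
     root of (T - x2)(T - x3). *)
  have : (x1 - x2) * (x1 - x3) = 0.
    have -> : (x1 - x2) * (x1 - x3) = e1 - x1 * e2 by rewrite /e1 /e2; ring.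
    by rewrite E1 E2; ring.
  have s4 : x4 = x2 + x3 - x1 by apply/esym/eqP; rewrite -subr_eq0 -E2 /e2; apply/eqP; ring.
  move/eqP; rewrite mulf_eq0 !subr_eq0 => /orP[] /eqP E.
    have /eqP := beta_inj E; rewrite /recip_trivial /= => ->.
    by rewrite (_ : b3 == b4) //; apply/eqP/beta_inj; rewrite -/x3 -/x4 s4 E; ring.
  rewrite /recip_trivial xpair_eqE; have /eqP := beta_inj E => ->.
  rewrite (_ : b2 == b4) ?orbT //; apply/eqP/beta_inj.
  by rewrite -/x2 -/x4 s4 E; ring.
have szP : (size P <= 3)%N by apply: leq_trans (size_Poly _) _.
set S := [set y | _].
have : (size (enum S) < size P)%N.
  apply: max_poly_roots => //; last exact: enum_uniq.
  apply/allP => y; rewrite mem_enum inE /recip_ok /= -/x1 -/x2 -/x3 -/x4.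
  case/and3P => /andP[h1 h2] /andP[h3 h4] /eqP h.
  rewrite /root horner_Poly /=.
  have : recip_defect y (b1, b2) (b3, b4) *
      ((y + x1) * (y + x2) * (y + x3) * (y + x4)) = 0 by rewrite h mul0r.
  rewrite /recip_defect /= -/x1 -/x2 -/x3 -/x4 => E; apply/eqP.
  by rewrite -[RHS]E /e2 /e1 /e0; field; rewrite h1 h2 h3 h4.
by rewrite -cardE; move/leq_trans/(_ szP).
Qed.

Lemma card_recip_trivial :
  (#|[set b : (J * J) * (J * J) | recip_trivial b.1 b.2]| <= 2 * #|J| ^ 2)%N.
Proof.
set S := [set b | _].
(* The boolean selects one of the two trivial families; each has two free indices. *)
pose f (u : bool * (J * J)) : (J * J) * (J * J) :=
  if u.1 then ((u.2.1, u.2.1), (u.2.2, u.2.2)) else (u.2, u.2).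
have sub : S \subset f @: setT.
  apply/subsetP => -[[b1 b2] [b3 b4]]; rewrite inE /recip_trivial /=.
  case/orP => [/andP[/eqP <- /eqP <-]|/eqP <-]; apply/imsetP.
    by exists (true, (b1, b3)).
  by exists (false, (b1, b2)).
apply: leq_trans (subset_leq_card sub) (leq_trans (leq_imset_card _ _) _).
by rewrite cardsT !card_prod card_bool mulnn.
Qed.

(** A trivial pair may vanish on all of [K], any other for at most two [y]. *)
Lemma sum_card_recip_defect_eq0 :
  (\sum_(b : (J * J) * (J * J))
     #|[set y | [&& recip_ok y b.1, recip_ok y b.2
                  & recip_defect y b.1 b.2 == 0%R]]|
   <= 2 * #|J| ^ 2 * #|K| + 2 * #|J| ^ 4)%N.
Proof.
rewrite (bigID (fun b : (J * J) * (J * J) => recip_trivial b.1 b.2)) /=.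
apply: leq_add.
  apply: (@leq_trans (\sum_(b : (J * J) * (J * J) | recip_trivial b.1 b.2) #|K|)).
    by apply: leq_sum => b _; apply: max_card.
  rewrite sum_nat_const leq_mul2r; apply/orP; right.
  by have := card_recip_trivial; rewrite cardsE.
apply: (@leq_trans (\sum_(b : (J * J) * (J * J) | ~~ recip_trivial b.1 b.2) 2)).
  by apply: leq_sum => b; apply: card_recip_defect_eq0.
rewrite sum_nat_const mulnC leq_mul2l /=; apply: leq_trans (max_card _) _.
by rewrite !card_prod !expnS expn0 muln1 !mulnA.
Qed.

Variables (R : realFieldType) (g : K -> R) (c : K -> J -> K).
Hypothesis g0 : \sum_s g s = 0.

(** Here [x = (y, z)] encodes y + p z, and [c y b] will be the Fermat quotient of y + b. *)
Definition fibre_sum (x : K * K) (s : K) : R :=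
  \sum_(b | x.1 + beta b != 0) g (c x.1 b - x.2 / (x.1 + beta b) - s).

(* For fixed [y] the sum over [z] vanishes unless [recip_defect] does, because the
   autocorrelation of [g] has mean zero. *)
Lemma fourth_moment_le :
  \sum_(x : K * K) (\sum_s fibre_sum x s ^+ 2) ^+ 2 <=
  (\sum_s g s ^+ 2) ^+ 2 * #|K|%:R *
  (2 * #|J| ^ 2 * #|K| + 2 * #|J| ^ 4)%N%:R.
Proof.
set S := \sum_s g s ^+ 2.
have S0 : 0 <= S by apply: sumr_ge0 => s _; apply: sqr_ge0.
pose q (y z : K) b := c y b - z / (y + beta b).
apply: (@le_trans _ _ (\sum_(x : K * K) S *
  (\sum_(b : J * J | recip_ok x.1 b) \sum_(b' : J * J | recip_ok x.1 b')
     autocorr g ((q x.1 x.2 b.1 - q x.1 x.2 b.2) -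
                 (q x.1 x.2 b'.1 - q x.1 x.2 b'.2))))).
  apply: ler_sum => x _; exact: energy_sqr_le.
rewrite -mulr_sumr -(pair_big xpredT xpredT
 (fun y z => \sum_(b : J * J | recip_ok y b) \sum_(b' : J * J | recip_ok y b')
     autocorr g ((q y z b.1 - q y z b.2) - (q y z b'.1 - q y z b'.2)))) /=.
rewrite expr2 -!mulrA ler_wpM2l //.
apply: (@le_trans _ _ (\sum_(y : K) \sum_(b : (J * J) * (J * J))
   if [&& recip_ok y b.1, recip_ok y b.2 & recip_defect y b.1 b.2 == 0]
   then S * #|K|%:R else 0)).
  apply: ler_sum => y _; rewrite exchange_big /=.
  under eq_bigr do rewrite exchange_big /=.
  rewrite pair_big /= big_mkcond /=; apply: ler_sum => -[b b'] _ /=.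
  case ok1 : (recip_ok y b) => //; case ok2 : (recip_ok y b') => //=.
  pose C := (c y b.1 - c y b.2) - (c y b'.1 - c y b'.2).
  rewrite (eq_bigr (fun z => autocorr g (C - z * recip_defect y b b'))); last first.
    by move=> z _; congr autocorr; rewrite /q /C /recip_defect; ring.
  case: eqP => [_|/eqP nz]; last by rewrite sum_autocorr_affine.
  apply: (@le_trans _ _ (\sum_(z : K) S)).
    by apply: ler_sum => z _; apply: autocorr_le.
  by rewrite sumr_const mulr_natr.
rewrite exchange_big /= mulrA; set Z := S * _.
have Z0 : 0 <= Z by rewrite mulr_ge0.
apply: (@le_trans _ _ (\sum_(b : (J * J) * (J * J)) Z *
     #|[set y | [&& recip_ok y b.1, recip_ok y b.2
                  & recip_defect y b.1 b.2 == 0%R]]|%:R)).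
  apply: ler_sum => b _; rewrite -big_mkcond /= sumr_const mulr_natr.
  by rewrite cardsE.
by rewrite -mulr_sumr -natr_sum ler_wpM2l // ler_nat sum_card_recip_defect_eq0.
Qed.

End ReciprocalEquation.

(** * The dispersion inequality *)

(** Cauchy-Schwarz twice. First [s] is extended from [A] to all of [K], where the translation by
    [th i] no longer matters. Then the [i] are grouped by [xi i], and the squares of the group sizes
    add up to the number of collisions. *)
Lemma dispersion_le (R : realFieldType) (K : finFieldType) (X I : finType)
    (xi : I -> X) (th : I -> K) (A : {set K}) (psi : X -> K -> R) :
  (\sum_i \sum_(s in A) psi (xi i) (s - th i)) ^+ 4 <=
  (#|I| * #|A|)%N%:R ^+ 2 * #|[set u : I * I | xi u.1 == xi u.2]|%:R *
  \sum_x (\sum_s psi x s ^+ 2) ^+ 2.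
Proof.
pose nu x : R := #|[set i | xi i == x]|%:R.
pose W := \sum_i \sum_s psi (xi i) s ^+ 2.
have W0 : 0 <= W by do 2!(apply: sumr_ge0 => ? _); apply: sqr_ge0.
have hD : (\sum_i \sum_(s in A) psi (xi i) (s - th i)) ^+ 2 <=
    (#|I| * #|A|)%N%:R * W.
  have -> : \sum_i \sum_(s in A) psi (xi i) (s - th i) =
      \sum_(u : I * K) (u.2 \in A)%:R * psi (xi u.1) (u.2 - th u.1).
    rewrite -(pair_big xpredT xpredT
      (fun i s => (s \in A)%:R * psi (xi i) (s - th i))) /=.
    apply: eq_bigr => i _; rewrite big_mkcond; apply: eq_bigr => s _.
    by case: (s \in A); rewrite ?mul1r ?mul0r.
  apply: le_trans (sum_cauchy_schwarz _ _) _.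
  rewrite -(pair_big xpredT xpredT (fun i s => psi (xi i) (s - th i) ^+ 2)) /=.
  rewrite -(pair_big xpredT xpredT (fun (i : I) s => (s \in A)%:R ^+ 2)) /=.
  rewrite le_eqVlt; apply/orP; left; apply/eqP; congr (_ * _).
    rewrite sumr_const -(mulr_natl _ #|I|) natrM; congr (_ * _).
    rewrite -sum1_card natr_sum [RHS]big_mkcond; apply: eq_bigr => s _.
    by case: (s \in A); rewrite ?expr1n ?expr0n.
  apply: eq_bigr => i _.
  exact: (sum_comp_inj (fun s => psi (xi i) s ^+ 2) (addIr (- th i))).
have hW : W ^+ 2 <= #|[set u : I * I | xi u.1 == xi u.2]|%:R *
  \sum_x (\sum_s psi x s ^+ 2) ^+ 2.
  have -> : W = \sum_x nu x * \sum_s psi x s ^+ 2.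
    rewrite /W (partition_big xi xpredT) //=; apply: eq_bigr => x _.
    rewrite (eq_bigr (fun=> \sum_s psi x s ^+ 2)) => [|i /eqP -> //].
    by rewrite sumr_const -mulr_natl /nu cardsE.
  have -> : #|[set u : I * I | xi u.1 == xi u.2]|%:R = \sum_x nu x ^+ 2.
    rewrite -sum1_card natr_sum.
    rewrite (partition_big (fun u : I * I => xi u.1) xpredT) //=.
    apply: eq_bigr => x _; rewrite /nu -sum1_card natr_sum expr2 big_distrlr /=.
    rewrite pair_big /= [LHS]big_mkcond [RHS]big_mkcond /=.
    apply: eq_bigr => -[i i'] _; rewrite !inE /= mul1r.
    by case: (xi i =P x) => [->|_]; rewrite ?andbF // eq_sym andbT.
  exact: sum_cauchy_schwarz.
rewrite (exprM _ 2 2) -mulrA.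
apply: (@le_trans _ _ (((#|I| * #|A|)%N%:R * W) ^+ 2)).
  by rewrite lerXn2r // nnegrE ?sqr_ge0 // mulr_ge0.
by rewrite exprMn ler_wpM2l // sqr_ge0.
Qed.

(** * Counting solutions of n a' = n' a *)

Lemma harmonic_le (R : realFieldType) (L A : nat) : (A < 2 ^ L)%N ->
  \sum_(1 <= d < A.+1) d%:R^-1 <= L%:R :> R.
Proof.
move=> hA; apply: (@le_trans _ _ (\sum_(1 <= d < 2 ^ L) d%:R^-1)).
  rewrite [leRHS](big_cat_nat (n := A.+1)) //= lerDl.
  by apply: sumr_ge0 => i _; rewrite invr_ge0.
(* The dyadic block starting at 2^L has 2^L terms, each at most 2^-L, so it adds at most 1. *)
elim: L {A hA} => [|L IH]; first by rewrite big_geq.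
have hL : (2 ^ L <= 2 ^ L.+1)%N by rewrite leq_exp2l.
rewrite (big_cat_nat (n := (2 ^ L)%N)) //= ?expn_gt0 // -natr1 lerD //.
apply: (@le_trans _ _ (\sum_(2 ^ L <= i < 2 ^ L.+1) (2 ^ L)%:R^-1)).
  rewrite !big_nat; apply: ler_sum => i /andP[hi _].
  by rewrite lef_pV2 ?ler_nat // posrE ltr0n ?expn_gt0 // (leq_trans _ hi) ?expn_gt0.
rewrite sumr_const_nat expnS mul2n -addnn addnK -[leLHS]mulr_natl mulfV //.
by rewrite pnatr_eq0 -lt0n expn_gt0.
Qed.

(** The members of the set share one residue modulo [e], so [n %/ e] determines [n]. *)
Lemma card_dvdn_interval (c m e : nat) : (0 < e)%N ->
  (#|[set n : 'I_m | (e %| c + n)%N]| <= m %/ e + 1)%N.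
Proof.
move=> e0; rewrite addn1 -[X in (_ <= X)%N]card_ord.
pose f (n : 'I_m) : 'I_(m %/ e).+1 := inord (n %/ e).
have fE n : f n = (n %/ e)%N :> nat.
  by rewrite inordK // ltnS leq_div2r // ltnW.
apply: (@leq_card_in _ _ f) => n n'; rewrite !inE => h h' /(congr1 val) /= .
rewrite !fE => E; apply: val_inj => /=.
have : (c + n == c + n' %[mod e])%N by rewrite (eqP h) (eqP h').
rewrite eqn_modDl => /eqP E2.
by rewrite (divn_eq n e) (divn_eq n' e) E E2.
Qed.

(** Let g be the gcd of a and a'. The equation forces e = a/g to divide c + n, and then n' is
    determined. It remains to count g, e, the value a'/g <= A/g, and the n with e dividing c + n. *)
Lemma card_collisions (R : realFieldType) (c m A : nat) :
  #|[set u : ('I_m * 'I_A) * ('I_m * 'I_A) |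
     ((c + u.1.1) * u.2.2.+1 == (c + u.2.1) * u.1.2.+1)%N]|%:R <=
  A%:R * (\sum_(1 <= d < A.+1) d%:R^-1) *
  (m%:R * (\sum_(1 <= d < A.+1) d%:R^-1) + A%:R) :> R.
Proof.
set S := [set u | _].
pose gc (u : ('I_m * 'I_A) * ('I_m * 'I_A)) := gcdn u.1.2.+1 u.2.2.+1.
pose f u : ('I_A.+1 * 'I_A.+1) * ('I_A.+1 * 'I_m) :=
  ((inord (gc u), inord (u.1.2.+1 %/ gc u)), (inord (u.2.2.+1 %/ gc u), u.1.1)).
have gc0 u : (0 < gc u)%N by rewrite gcdn_gt0.
have gcl u : (gc u %| u.1.2.+1)%N by apply: dvdn_gcdl.
have gcr u : (gc u %| u.2.2.+1)%N by apply: dvdn_gcdr.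
have f11 u : (f u).1.1 = gc u :> nat.
  by rewrite inordK // ltnS (leq_trans (dvdn_leq _ (gcl u))).
have f12 u : (f u).1.2 = (u.1.2.+1 %/ gc u)%N :> nat.
  by rewrite inordK // ltnS (leq_trans (leq_div _ _)).
have f21 u : (f u).2.1 = (u.2.2.+1 %/ gc u)%N :> nat.
  by rewrite inordK // ltnS (leq_trans (leq_div _ _)).
have f_inj : {in S &, injective f}.
  move=> u v hu hv E.
  have E1 : gc u = gc v by rewrite -(f11 u) -(f11 v) E.
  have E2 : u.1.2 = v.1.2.
    apply: val_inj; apply: succn_inj => /=.
    by rewrite -(divnK (gcl u)) -(divnK (gcl v)) -(f12 u) -(f12 v) E E1.
  have E3 : u.2.2 = v.2.2.
    apply: val_inj; apply: succn_inj => /=.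
    by rewrite -(divnK (gcr u)) -(divnK (gcr v)) -(f21 u) -(f21 v) E E1.
  have E4 : u.1.1 = v.1.1 by have := congr1 (fun w => w.2.2) E.
  have E5 : u.2.1 = v.2.1.
    apply: val_inj => /=; move: hu hv; rewrite !inE E4 E3 E2 => /eqP -> /eqP.
    by move/eqP; rewrite eqn_pmul2r // eqn_add2l => /eqP.
  by case: u v E2 E3 E4 E5 {hu hv E E1} => [[? ?] [? ?]] [[? ?] [? ?]] /= -> -> -> ->.
pose T := [set w : ('I_A.+1 * 'I_A.+1) * ('I_A.+1 * 'I_m) |
  [&& 0 < w.1.1, 0 < w.1.2, 0 < w.2.1, w.2.1 * w.1.1 <= A
    & w.1.2 %| c + w.2.2]%N].
have fT : f @: S \subset T.
  apply/subsetP => _ /imsetP[u hu ->]; rewrite inE f11 f12 f21 gc0 /=.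
  rewrite !divn_gt0 // (dvdn_leq _ (gcl u)) // (dvdn_leq _ (gcr u)) //=.
  rewrite divnK // (ltn_ord u.2.2) /=.
  have cop : coprime (u.1.2.+1 %/ gc u) (u.2.2.+1 %/ gc u).
    by rewrite /coprime -(eqn_pmul2r (gc0 u)) muln_gcdl !divnK // mul1n.
  rewrite -(Gauss_dvdl _ cop); apply/dvdnP; exists (c + u.2.1)%N.
  apply/eqP; rewrite -(eqn_pmul2r (gc0 u)) -!mulnA !divnK //.
  by rewrite inE in hu.
have cardT : (#|T| <= \sum_(g < A.+1) \sum_(e < A.+1)
    if (0 < g) && (0 < e) then (A %/ g) * (m %/ e + 1) else 0)%N.
  have -> : #|T| = (\sum_g \sum_e \sum_v if ((g, e), v) \in T then 1 else 0)%N.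
    rewrite pair_bigA pair_bigA -sum1_card big_mkcond.
    by apply: eq_bigr => -[[g e] v] _.
  apply: leq_sum => g _; apply: leq_sum => e _.
  case: ifP => [/andP[g0 e0]|ge0]; last first.
    by rewrite big1 // => v _; rewrite inE /= andbA ge0.
  rewrite -big_mkcond sum1_card.
  pose Fg := [set (inord j.+1 : 'I_A.+1) | j : 'I_(A %/ g)].
  apply: (@leq_trans #|setX Fg [set n : 'I_m | e %| c + n]%N|); last first.
    rewrite cardsX leq_mul ?card_dvdn_interval //.
    by apply: leq_trans (leq_imset_card _ _) _; rewrite card_ord.
  apply: subset_leq_card; apply/subsetP => -[x n].
  move=> h; have {h} : ((g, e), (x, n)) \in T by exact: h.
  rewrite inE /= g0 e0 /= => /and3P[x0 xA xn].
  rewrite in_setX [n \in _]inE xn andbT; have xg : (x.-1 < A %/ g)%N.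
    by rewrite prednK // leq_divRL.
  apply/imsetP; exists (Ordinal xg) => //=.
  by apply: val_inj; rewrite /= prednK // inordK.
apply: (@le_trans _ _ #|T|%:R).
  by rewrite -(card_in_imset f_inj) ler_nat subset_leq_card.
(* The index 0 adds nothing: the inverse of 0 is 0, and the indicator of [0 < e] cancels the other
   term. *)
apply: (@le_trans _ _ (\sum_(g < A.+1) \sum_(e < A.+1)
    (A%:R * g%:R^-1) * (m%:R * e%:R^-1 + (0 < e)%N%:R))).
  move: cardT; rewrite -(ler_nat R) => /le_trans; apply.
  rewrite natr_sum; apply: ler_sum => g _; rewrite natr_sum; apply: ler_sum => e _.
  have divr_le (a d : nat) : (0 < d)%N -> (a %/ d)%N%:R <= a%:R * d%:R^-1 :> R.
    by move=> d0; rewrite ler_pdivlMr ?ltr0n // -natrM ler_nat leq_divM.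
  case: ifP => [/andP[g0 e0]|_]; last by rewrite !mulr_ge0 ?addr_ge0 ?mulr_ge0 ?invr_ge0.
  by rewrite natrM e0 ler_pM // ?divr_le // natrD lerD2r divr_le.
have H0 (F : nat -> R) : F 0%N = 0 ->
    \sum_(d < A.+1) F d = \sum_(1 <= d < A.+1) F d.
  by move=> F0; rewrite -(big_mkord xpredT) big_ltn // F0 add0r.
rewrite -big_distrlr /= -!mulr_sumr big_split /= -mulr_sumr.
rewrite !(H0 (fun d => d%:R^-1)) ?invr0 // (H0 (fun d => (0 < d)%N%:R)) //.
rewrite (eq_big_nat _ _ (F1 := fun d => (0 < d)%N%:R) (F2 := fun=> 1)) => [|d /andP[-> _] //].
by rewrite sumr_const_nat subSS subn0.
Qed.

(** * Arithmetic of Fermat quotients *)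

Section FermatQuotient.

Variable p : nat.
Hypothesis p_pr : prime p.

Definition fq (u : nat) : 'F_p := (fermat_quotient p u)%:R.

Lemma natr_Fp_eq0 (n : nat) : (n%:R == 0 :> 'F_p) = (p %| n)%N.
Proof. by rewrite (dvdn_pcharf (pchar_Fp p_pr)). Qed.

Lemma natr_Fp_inj (m n : nat) :
  (m < p)%N -> (n < p)%N -> m%:R = n%:R :> 'F_p -> m = n.
Proof.
by move=> hm hn /(congr1 val) /=; rewrite !val_Fp_nat // !modn_small.
Qed.

Lemma fq_exp (u : nat) : ~~ (p %| u)%N ->
  exists2 k, (u ^ (p - 1) = 1 + p * k)%N & fq u = k%:R.
Proof.
move=> pu; exists ((u ^ (p - 1) - 1) %/ p)%N; last first.
  by rewrite /fq /fermat_quotient (negPf pu) Fp_nat_mod.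
have cop : coprime u p by rewrite coprime_sym prime_coprime.
have u0 : (0 < u ^ (p - 1))%N by rewrite expn_gt0; case: (u) pu; rewrite ?dvdn0.
have := Euler_exp_totient cop; rewrite totient_prime // -subn1.
move/eqP; rewrite eqn_mod_dvd // => /divnK; lia.
Qed.

(** The equation says u^(p-1) = 1 + p k modulo p^2, with a multiple of p^2 on either side to avoid
    subtraction in [nat]. *)
Lemma fq_unique (u k w w' : nat) : ~~ (p %| u)%N ->
  (u ^ (p - 1) + p * (p * w') = 1 + p * k + p * (p * w))%N -> fq u = k%:R.
Proof.
move=> /fq_exp[k0 -> ->] E.
have {}E : (k0 + p * w' = k + p * w)%N.
  by apply/eqP; rewrite -(eqn_pmul2l (prime_gt0 p_pr)); apply/eqP; lia.
by have := congr1 (fun n => n%:R : 'F_p) E; rewrite !natrD !natrM pchar_Fp_0 // !mul0r !addr0.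
Qed.

Lemma fqM (u v : nat) : ~~ (p %| u)%N -> ~~ (p %| v)%N ->
  fq (u * v) = fq u + fq v.
Proof.
move=> pu pv; have [k Ek ->] := fq_exp pu; have [l El ->] := fq_exp pv.
rewrite -natrD; apply: (@fq_unique _ _ (k * l) 0); first by rewrite Euclid_dvdM // negb_or pu.
rewrite expnMn Ek El; ring.
Qed.

Lemma expnD_mod_sqr (u z m : nat) : exists w,
  ((u + p * z) ^ m.+1 = u ^ m.+1 + p * (m.+1 * z * u ^ m) + p * (p * w))%N.
Proof.
elim: m => [|m [w IH]]; first by exists 0%N; rewrite !expn1 expn0; ring.
exists (m.+1 * z * u ^ m * z + w * (u + p * z))%N.
rewrite expnS IH !(expnS u); ring.
Qed.

(** To first order u^(p-1) changes by p (p-1) z u^(p-2); in ['F_p], p - 1 is -1 and u^(p-2) is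
    1/u. *)
Lemma fqD_mulp (u z : nat) : ~~ (p %| u)%N ->
  fq (u + p * z) = fq u - z%:R / u%:R.
Proof.
move=> pu; have [k Ek ->] := fq_exp pu; have p1 := prime_gt1 p_pr.
have u0 : u%:R != 0 :> 'F_p by rewrite natr_Fp_eq0.
have [w Ew] := expnD_mod_sqr u z (p - 2).
have pm : (p - 2).+1 = (p - 1)%N by lia.
rewrite pm in Ew.
rewrite (@fq_unique _ (k + (p - 1) * z * u ^ (p - 2)) w 0); first last.
- by rewrite Ew Ek; ring.
- by rewrite dvdn_addl ?dvdn_mulr.
have h1 : (p - 1)%N%:R = -1 :> 'F_p by rewrite natrB ?pchar_Fp_0 ?sub0r // ltnW.
have h2 : (u ^ (p - 2))%N%:R = u%:R^-1 :> 'F_p.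
  apply: (mulfI u0); rewrite mulfV // -natrM -expnS pm Ek natrD natrM.
  by rewrite pchar_Fp_0 // mul0r addr0.
by rewrite natrD !natrM h1 h2; ring.
Qed.

(** A shift by a multiple of p^2 is the case of [fqD_mulp] in which z vanishes in ['F_p]. *)
Lemma fq_mod (u v : nat) : ~~ (p %| u)%N -> (u = v %[mod p ^ 2])%N ->
  fq u = fq v.
Proof.
move=> pu E.
have fq_modn w : ~~ (p %| w)%N -> fq w = fq (w %% p ^ 2).
  move=> pw; rewrite {1}(divn_eq w (p ^ 2)) addnC mulnC -mulnn -mulnA fqD_mulp.
    by rewrite natrM pchar_Fp_0 // mul0r mul0r subr0.
  by rewrite /dvdn modn_dvdm // dvdn_mulr.
have Ep : (u = v %[mod p])%N.
  by have := congr1 (modn^~ p) E; rewrite /= !modn_dvdm // dvdn_mulr.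
by rewrite fq_modn // E -fq_modn // /dvdn -Ep.
Qed.

End FermatQuotient.

(** * Fixed points in one block *)

Section Block.

Variables p N A B M : nat.
Hypotheses (p_pr : prime p) (p_gt2 : (2 < p)%N) (A_gt0 : (0 < A)%N) (B_gt0 : (0 < B)%N).
Hypotheses (AB_le : (A * B <= N)%N) (N_le : (N <= p)%N) (NM : (N <= M)%N).
Hypotheses (M_lt : (M < p)%N) (B_sqr : (B ^ 2 <= p)%N) (A_le : (2 * A <= p)%N).

Local Notation I := ('I_(2 * N) * 'I_A)%type.

(* [quo i] is the residue of [num i / den i] modulo [p ^ 2]; [pt i] is the pair
   [(y, z)] with [quo i = y + p z]. *)
Definition num (i : I) : nat := ((M - N).+1 + i.1)%N.
Definition den (i : I) : nat := i.2.+1.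
Definition quo (i : I) : nat :=
  ((num i * den i ^ (totient (p ^ 2) - 1)) %% p ^ 2)%N.
Definition pt (i : I) : 'F_p * 'F_p := ((quo i)%:R, (quo i %/ p)%:R).

Lemma den_ndvd (i : I) : ~~ (p %| den i)%N.
Proof. by rewrite gtnNdvd //; have := ltn_ord i.2; rewrite /den; lia. Qed.

Lemma quoP (i : I) : (den i * quo i = num i %[mod p ^ 2])%N.
Proof.
rewrite modnMmr mulnCA -expnS subn1 prednK; last first.
  by rewrite totient_gt0 expn_gt0 prime_gt0.
rewrite -modnMmr Euler_exp_totient ?modnMmr ?muln1 //.
by rewrite coprime_pexpr // coprime_sym prime_coprime // den_ndvd.
Qed.

(** [pt i] holds the base p digits of [quo i], so the fractions agree modulo p^2. Both cross
    products are below 2 p A <= p^2, which turns the congruence into an equality. *)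
Lemma pt_collision (i j : I) :
  pt i = pt j -> (num i * den j = num j * den i)%N.
Proof.
case=> E1 E2; have p0 := prime_gt0 p_pr.
have quo_lt k : (quo k < p ^ 2)%N by rewrite ltn_mod expn_gt0 p0.
have div_lt k : (quo k %/ p < p)%N by rewrite ltn_divLR // mulnn.
have E : quo i = quo j.
  rewrite (divn_eq (quo i) p) (divn_eq (quo j) p).
  rewrite (natr_Fp_inj p_pr (div_lt i) (div_lt j) E2).
  by have /(congr1 val) := E1; rewrite /= !val_Fp_nat // => ->.
have lt k l : (num k * den l < p ^ 2)%N.
  have h1 : (num k < 2 * p)%N by have := ltn_ord k.1; rewrite /num; lia.
  have h2 : (den l <= A)%N by rewrite /den ltn_ord.
  rewrite -mulnn; nia.
rewrite -(modn_small (lt i j)) -(modn_small (lt j i)).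
by rewrite -[LHS]modnMml -quoP modnMml E -mulnA (mulnC (quo j)) -modnMmr quoP modnMmr mulnC.
Qed.

(** Modulo p^2 the argument is den (quo + b), and quo + b = (y + b) + p z; apply [fqM] and
    [fqD_mulp]. *)
Lemma fq_pt (i : I) (b : 'I_B) : ~~ (p %| num i + den i * b)%N ->
  (pt i).1 + b%:R != 0 /\
  fq p (num i + den i * b) =
  fq p (den i) + (fq p ((pt i).1 + b) - (pt i).2 / ((pt i).1 + b%:R)).
Proof.
move=> ndvd; have p0 := prime_gt0 p_pr.
have E : (num i + den i * b = den i * (quo i + b) %[mod p ^ 2])%N.
  by rewrite mulnDr -modnDml -quoP modnDml.
have ndvd2 : ~~ (p %| quo i + b)%N.
  apply: contra ndvd => h; rewrite /dvdn -(@modn_dvdm (p ^ 2)) ?dvdn_mulr // E.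
  by rewrite modn_dvdm ?dvdn_mulr // -/(dvdn _ _) dvdn_mull.
have nz : (pt i).1 + b%:R != 0 by rewrite -natrD natr_Fp_eq0.
split=> //; rewrite (fq_mod p_pr ndvd E) fqM ?den_ndvd //; congr (_ + _).
have -> : (pt i).1 = (quo i %% p)%N :> nat by rewrite /= val_Fp_nat.
have e : (quo i + b = quo i %% p + b + p * (quo i %/ p))%N.
  by rewrite {1}(divn_eq (quo i) p); ring.
rewrite {1}e fqD_mulp //; last by rewrite e dvdn_addl ?dvdn_mulr in ndvd2.
by rewrite natrD Fp_nat_mod.
Qed.

Definition fixed_in_block : {set 'I_N} :=
  [set j : 'I_N | ~~ (p %| M + j)%N && (fermat_quotient p (M + j) == M + j)%N].

Definition low : {set 'F_p} := [set j%:R | j : 'I_N].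
Definition window : {set 'F_p} := [set ((M - N).+1 + i)%:R | i : 'I_(2 * N)].

Lemma card_low : #|low| = N.
Proof.
rewrite card_imset ?card_ord // => j j' /natr_Fp_inj E; apply: val_inj.
by apply: E; rewrite ?(leq_trans (ltn_ord _)).
Qed.

Lemma card_window : (#|window| <= 2 * N)%N.
Proof. by apply: leq_trans (leq_imset_card _ _) _; rewrite card_ord. Qed.

(** For 0 <= t < N, M + j - t lies between M - N + 1 and M + N - 1, inside [window]. This smooths
    the interval condition: each point M + j gets exactly N representations s + t. *)
Lemma card_window_low (j : 'I_N) :
  #|[set s in window | (M + j)%:R - s \in low]| = N.
Proof.
rewrite -[RHS]card_low -(card_imset low (inj_comp (addrI (M + j)%:R) (@oppr_inj _))).
apply: eq_card => s; rewrite !inE; apply/andP/imsetP => [[_ h]|[t h ->]].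
  by exists ((M + j)%:R - s) => //=; ring.
have -> : (M + j)%:R - ((M + j)%:R - t) = t by ring.
split=> //; case/imsetP: h => k _ ->; apply/imsetP.
have lt : (N + j - k.+1 < 2 * N)%N by have := ltn_ord j; have := ltn_ord k; lia.
exists (Ordinal lt) => //=; rewrite -natrB; last by have := ltn_ord k; lia.
by congr _%:R; have := ltn_ord k; lia.
Qed.

(** [y] enters by its least residue and the sum y + b is not reduced modulo p, because [fq] is
    periodic modulo p^2 only. *)
Definition shifted_fq (y : 'F_p) (b : 'I_B) : 'F_p := fq p (y + b).

Definition pt_fq (i : I) (b : 'I_B) : 'F_p :=
  shifted_fq (pt i).1 b - (pt i).2 / ((pt i).1 + b%:R).

(** A fixed point u is n + a b for each of the A B pairs. By [fq_pt], [pt_fq i b + fq p (den i)] is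
    then q(u) = u, and [card_window_low] supplies N values of [s]. *)
Lemma block_count_le (R : realFieldType) :
  (#|fixed_in_block| * A * B * N)%N%:R <=
  \sum_i \sum_(s in window) \sum_(b : 'I_B | (pt i).1 + b%:R != 0)
    (pt_fq i b - (s - fq p (den i)) \in low)%:R :> R.
Proof.
pose W i (b : 'I_B) : R := if (pt i).1 + b%:R != 0 then
  \sum_(s in window) (pt_fq i b - (s - fq p (den i)) \in low)%:R else 0.
have W0 i b : 0 <= W i b by rewrite /W; case: ifP => // _; apply: sumr_ge0.
have -> : \sum_i \sum_(s in window) \sum_(b : 'I_B | (pt i).1 + b%:R != 0)
    (pt_fq i b - (s - fq p (den i)) \in low)%:R =
    \sum_(a < A) \sum_(b < B) \sum_(n < 2 * N) W (n, a) b.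
  under [RHS]eq_bigr do rewrite exchange_big.
  rewrite [RHS]exchange_big pair_bigA /=; apply: eq_bigr => -[n a] _.
  by rewrite exchange_big /= big_mkcond.
have -> : (#|fixed_in_block| * A * B * N)%N%:R =
    \sum_(a < A) \sum_(b < B) (#|fixed_in_block| * N)%N%:R :> R.
  by rewrite !sumr_const !card_ord -!mulrnA; congr _%:R; ring.
apply: ler_sum => a _; apply: ler_sum => b _.
(* This is the offset in [num] of the numerator n = M + j - (a+1) b, the denominator being
   [a.+1]. *)
have lt (j : 'I_N) : ((N - 1 + j) - a.+1 * b < 2 * N)%N by have := ltn_ord j; lia.
pose h (j : 'I_N) : 'I_(2 * N) := Ordinal (lt j).
have hab : (a.+1 * b <= N - 1)%N.
  have := ltn_ord a; have := ltn_ord b => hb ha.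
  have h1 : (a.+1 * b <= A * b)%N by rewrite leq_mul2r ha orbT.
  have h2 : (A * b.+1 <= A * B)%N by rewrite leq_mul2l hb orbT.
  move: h2; rewrite mulnS; lia.
have h_inj : injective h.
  by move=> j j' /(congr1 val) /= E; apply: val_inj => /=; lia.
have Wh j : j \in fixed_in_block -> W (h j, a) b = N%:R.
  rewrite inE => /andP[nd /eqP E].
  have E1 : (num (h j, a) + den (h j, a) * b = M + j)%N.
    by rewrite /num /den /=; have := ltn_ord j; lia.
  have := fq_pt (i := (h j, a)) (b := b); rewrite E1 => /(_ nd)[nz E2].
  rewrite /W nz -[in RHS](card_window_low j) -sum1_card natr_sum.
  rewrite [LHS]big_mkcond [RHS]big_mkcond; apply: eq_bigr => s _.
  rewrite !inE; case: (s \in window) => //=.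
  rewrite (_ : pt_fq _ b - _ = (M + j)%:R - s); first by case: (_ \in low).
  by rewrite -[in RHS]E -/(fq p _) E2 /pt_fq /shifted_fq; ring.
apply: (@le_trans _ _ (\sum_(n in h @: fixed_in_block) W (n, a) b)).
  rewrite big_imset /=; last by move=> ? ? _ _; apply: h_inj.
  by rewrite (eq_bigr _ Wh) sumr_const -mulrnA mulnC.
by rewrite [leRHS](bigID (mem (h @: fixed_in_block))) /= lerDl sumr_ge0.
Qed.

Definition centred_low (R : realFieldType) (t : 'F_p) : R :=
  (t \in low)%:R - N%:R / p%:R.

Lemma sum_low (R : realFieldType) : \sum_t (t \in low)%:R = N%:R :> R.
Proof.
rewrite -[in RHS]card_low -sum1_card natr_sum [RHS]big_mkcond.
by apply: eq_bigr => t _; case: (t \in low).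
Qed.

Lemma sum_centred_low (R : realFieldType) : \sum_t centred_low R t = 0.
Proof.
rewrite sumrB sum_low sumr_const card_Fp // -[_ *+ p]mulr_natr divfK ?subrr //.
by rewrite pnatr_eq0 -lt0n prime_gt0.
Qed.

Lemma sum_centred_low_sqr (R : realFieldType) :
  \sum_t centred_low R t ^+ 2 <= N%:R.
Proof.
(* An indicator is its own square. *)
have -> : \sum_t centred_low R t ^+ 2 =
    \sum_t ((t \in low)%:R - (N%:R / p%:R) * centred_low R t
            - (N%:R / p%:R) * (t \in low)%:R).
  apply: eq_bigr => t _; rewrite /centred_low.
  by case: (t \in low); rewrite /=; ring.
rewrite !sumrB -!mulr_sumr sum_centred_low sum_low mulr0 subr0 lerBlDr lerDl.
by rewrite !mulr_ge0 ?invr_ge0.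
Qed.

(** The factors from [dispersion_le] are at most (4 N^2 A)^2, 4 N A L^2 for the collisions, and 4
    N^2 B^2 p^2 for the fourth moment, where B^2 <= p absorbs the term in B^4. *)
Lemma block_dispersion (R : realFieldType) (L : nat) : (A < 2 ^ L)%N ->
  (\sum_i \sum_(s in window) fibre_sum (fun b : 'I_B => b%:R) (centred_low R)
      shifted_fq (pt i) (s - fq p (den i))) ^+ 4 <=
  256%:R * N%:R ^+ 7 * A%:R ^+ 3 * B%:R ^+ 2 * p%:R ^+ 2 * L%:R ^+ 2.
Proof.
move=> hL.
have L0 : (0 < L)%N by case: (L) hL => //; rewrite expn0 ltnNge A_gt0.
apply: le_trans (dispersion_le _ _ _ _) _.
have char2 : 2%:R != 0 :> 'F_p by rewrite natr_Fp_eq0 // gtnNdvd.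
have beta_inj : injective (fun b : 'I_B => b%:R : 'F_p).
  move=> b b' /natr_Fp_inj E; apply: val_inj; have := ltn_ord b; have := ltn_ord b'.
  by move: B_sqr => /= *; apply: E => //; nia.
have hM := fourth_moment_le char2 beta_inj shifted_fq (sum_centred_low R).
rewrite card_Fp // card_ord in hM.
set E := #|_|%:R; set Q := \sum_x _ in hM *; set S := \sum_s _ in hM.
have S0 : 0 <= S by apply: sumr_ge0 => s _; apply: sqr_ge0.
have hS : S ^+ 2 <= N%:R ^+ 2.
  by rewrite lerXn2r ?nnegrE // sum_centred_low_sqr.
have hQ : Q <= N%:R ^+ 2 * p%:R * (4 * B ^ 2 * p)%N%:R.
  apply: le_trans hM _; apply: ler_pM; rewrite ?mulr_ge0 ?sqr_ge0 //.
    by rewrite ler_wpM2r.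
  rewrite ler_nat; have : (B ^ 2 * B ^ 2 <= B ^ 2 * p)%N by rewrite leq_mul2l B_sqr orbT.
  by rewrite -expnD; lia.
have hE : E <= 4 * N%:R * A%:R * L%:R ^+ 2.
  apply: (@le_trans _ _ #|[set u : ('I_(2 * N) * 'I_A) * ('I_(2 * N) * 'I_A) |
     (((M - N).+1 + u.1.1) * u.2.2.+1 == ((M - N).+1 + u.2.1) * u.1.2.+1)%N]|%:R).
    rewrite ler_nat; apply: subset_leq_card; apply/subsetP => u.
    by rewrite !inE => /eqP /pt_collision ->.
  apply: le_trans (card_collisions R _ _ _) _.
  have := @harmonic_le R _ _ hL; set H := \sum_(1 <= d < _) _ => hH.
  have H0 : 0 <= H by apply: sumr_ge0 => d _; rewrite invr_ge0.
  have hAN : A%:R <= N%:R :> R.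
    by rewrite ler_nat (leq_trans _ AB_le) // leq_pmulr.
  apply: (@le_trans _ _ (A%:R * L%:R * ((2 * N)%N%:R * L%:R + (2 * N)%N%:R * L%:R))).
    apply: ler_pM; rewrite ?addr_ge0 ?mulr_ge0 //; first by rewrite ler_wpM2l.
    rewrite lerD ?ler_wpM2l // (le_trans hAN) // -natrM ler_nat -mulnA mulnCA.
    by rewrite leq_pmulr // muln_gt0 L0.
  by rewrite natrM le_eqVlt; apply/orP; left; apply/eqP; ring.
apply: (@le_trans _ _ ((2 * N * A * (2 * N))%N%:R ^+ 2 *
    (4 * N%:R * A%:R * L%:R ^+ 2) * (N%:R ^+ 2 * p%:R * (4 * B ^ 2 * p)%N%:R))).
  apply: ler_pM => //; first by rewrite mulr_ge0 ?sqr_ge0.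
    by apply: sumr_ge0 => x _; apply: sqr_ge0.
  apply: ler_pM; rewrite ?sqr_ge0 // lerXn2r ?nnegrE // ler_nat.
  by rewrite card_prod !card_ord leq_mul2l card_window orbT.
by rewrite !natrM le_eqVlt; apply/orP; left; apply/eqP; ring.
Qed.

(** If the count is at most twice its mean term [Y], the first bound follows. Otherwise T A B N <= 2
    D, and its fourth power with [block_dispersion] gives the second, where 2^12 = 16 * 256. *)
Lemma block_bound (L : nat) : (A < 2 ^ L)%N ->
  (p * #|fixed_in_block| <= 8 * N ^ 2)%N \/
  (#|fixed_in_block| ^ 4 * A * B ^ 2 <= 2 ^ 12 * N ^ 3 * p ^ 2 * L ^ 2)%N.
Proof.
move=> hL; have := @block_dispersion rat _ hL; set D := \sum_i _ => hD.
set T := #|_|; pose Y : rat := N%:R / p%:R * (2 * N * A * (2 * N) * B)%N%:R.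
have N_gt0 : (0 < N)%N by rewrite (leq_trans _ AB_le) // muln_gt0 A_gt0.
have p0 : 0 < p%:R :> rat by rewrite ltr0n prime_gt0.
have hX : (T * A * B * N)%N%:R <= D + Y.
  apply: le_trans (block_count_le _) _.
  (* The mean N / p is nonnegative, so its sum may be extended to all [b]. *)
  apply: (@le_trans _ _ (D + \sum_(i : I) \sum_(s in window) \sum_(b < B)
      N%:R / p%:R)).
    rewrite -big_split; apply: ler_sum => i _ /=.
    rewrite -big_split; apply: ler_sum => s _ /=.
    rewrite -lerBlDl /fibre_sum -sumrB.
    apply: (@le_trans _ _ (\sum_(b : 'I_B | (pt i).1 + b%:R != 0) N%:R / p%:R)).
      apply: ler_sum => b _; rewrite /centred_low /pt_fq; lra.
    rewrite [leRHS](bigID (fun b : 'I_B => (pt i).1 + b%:R != 0)) /= lerDl.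
    by apply: sumr_ge0 => b _; rewrite divr_ge0.
  rewrite lerD2l !sumr_const card_prod !card_ord -!mulrnA -[_ *+ _]mulr_natr.
  rewrite ler_wpM2l ?divr_ge0 // ler_nat.
  have := leq_mul (leq_mul (leqnn (2 * N * A)) card_window) (leqnn B).
  by congr (_ <= _)%N; ring.
have [hY|hY] := leP ((T * A * B * N)%N%:R) (2 * Y).
  left; rewrite -(@leq_pmul2r (A * B * N)) ?muln_gt0 ?A_gt0 ?B_gt0 //.
  have : p%:R * (T * A * B * N)%N%:R <= (8 * N ^ 2 * (A * B * N))%N%:R :> rat.
    apply: le_trans (ler_wpM2l (ltW p0) hY) _; rewrite /Y !natrM le_eqVlt.
    by apply/orP; left; apply/eqP; field; rewrite gt_eqF.
  by rewrite -natrM ler_nat; congr (_ <= _)%N; ring.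
right; rewrite -(@leq_pmul2r (N ^ 4 * A ^ 3 * B ^ 2)); last first.
  by rewrite !muln_gt0 N_gt0 A_gt0 B_gt0.
have h16 : (T * A * B * N)%N%:R ^+ 4 <= 16%:R * D ^+ 4.
  have -> : 16%:R * D ^+ 4 = (2 * D) ^+ 4 by ring.
  have X0 : 0 <= (T * A * B * N)%N%:R :> rat by [].
  by rewrite lerXn2r // ?nnegrE //; lra.
have {}h16 := le_trans h16 (ler_wpM2l (ler0n _ 16) hD).
rewrite -(ler_nat rat) !(natrM, natrX) in h16 *.
by move: h16; congr (_ <= _); ring.
Qed.

End Block.

Close Scope ring_scope.

(** * Assembling the blocks and choosing the parameters *)

Lemma F_le_blocks (p N T : nat) : 0 < N ->
  (forall k, 0 < k -> k * N < p -> #|fixed_in_block p N (k * N)| <= T) ->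
  F p <= N + p %/ N * T.
Proof.
move=> N0 hT.
pose a u := (u < p) && (fermat_quotient p u == u).
have block_le k : 0 < k -> count a (iota (k * N) N) <= T.
  move=> k0; have [kNp|kNp] := ltnP (k * N) p; last first.
    rewrite (@eq_in_count _ a pred0) ?count_pred0 // => u.
    by rewrite mem_iota /a => /andP[h _]; rewrite ltnNge (leq_trans kNp h).
  apply: leq_trans (hT k k0 kNp).
  rewrite -{1}[k * N]addn0 iotaDl count_map -val_enum_ord count_map.
  set S := fixed_in_block _ _ _.
  have -> : #|S| = count (mem S) (enum 'I_N) by rewrite cardE enumT -size_filter.
  apply: sub_count => j /=; rewrite inE /a => /andP[lt E]; apply/andP; split=> //.
  by rewrite gtnNdvd // addn_gt0 muln_gt0 k0 N0.
have blocks_le m : count a (iota 0 (m.+1 * N)) <= N + m * T.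
  (* The first block [0, N) is counted trivially: the hypothesis N <= M of a block fails there. *)
  elim: m => [|m IH]; first by rewrite mul1n addn0 -[X in _ <= X](size_iota 0) count_size.
  rewrite (mulSn m.+1 N) (addnC N) iotaD count_cat add0n (mulSn m T) (addnC T) addnA.
  by rewrite leq_add // block_le.
apply: leq_trans (blocks_le _).
have pN : p <= (p %/ N).+1 * N by rewrite ltnW // -ltn_divLR.
rewrite -(subnKC pN) iotaD count_cat /F.
rewrite (@eq_in_count _ _ a) ?leq_addr // => u; rewrite mem_iota /a => /andP[_ ->].
by [].
Qed.

(** N, A, B have orders p^(11/12), p^(5/12), p^(1/2), with integer powers in place of roots. Up to
    logarithms both cases of [block_bound] then give T of order at most p^(5/6), which balances N
    against (p / N) T. *)
Record burgess_params (p N A B L : nat) : Prop := BurgessParams {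
  bp_N_ge : p ^ 11 <= N ^ 12;
  bp_N_le : N ^ 12 <= 2 ^ 12 * p ^ 11;
  bp_N_le_p : N <= p;
  bp_A : 0 < A;
  bp_B : 0 < B;
  bp_AB : A * B <= N;
  bp_N_AB : N <= 2 * (A * B);
  bp_B_sqr : B ^ 2 <= p;
  bp_p_B : p <= 4 * B ^ 2;
  bp_A_le : 2 * A <= p;
  bp_L_gt0 : 0 < L;
  bp_L : A < 2 ^ L;
  bp_L_le : 2 ^ L <= 2 * p
}.

Lemma burgess_params_exist (p : nat) : 3 < p ->
  exists N A B L, burgess_params p N A B L.
Proof.
move=> p3.
(* [B] is to be the integer square root of [p]. *)
have exB : exists b, p < b.+1 ^ 2 by exists p; rewrite -mulnn; nia.
have [B hB minB] := ex_minnP exB.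
have B1 : 1 < B by rewrite ltnNge; apply/negP; case: (B) hB => [|[|]] //; lia.
have B2 : B ^ 2 <= p.
  rewrite leqNgt; apply/negP => h; have := minB B.-1; rewrite prednK; last lia.
  by move/(_ h); lia.
have exN : exists n, p ^ 11 <= n ^ 12 by exists p; rewrite leq_pexp2l //; lia.
have [N hN minN] := ex_minnP exN.
have Np : N <= p by apply: minN; rewrite leq_pexp2l //; lia.
have N1 : 1 < N.
  rewrite ltnNge; apply/negP => h; have : N ^ 12 <= 1 ^ 12 by rewrite leq_exp2r.
  have : 1 < p ^ 11 by rewrite -(exp1n 11) ltn_exp2r //; lia.
  rewrite exp1n; lia.
(* By minimality (N - 1)^12 < p^11, and N <= 2 (N - 1). *)
have N4 : N ^ 12 <= 2 ^ 12 * p ^ 11.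
  have h : N.-1 ^ 12 <= p ^ 11.
    by rewrite leqNgt; apply/negP => /ltnW /minN; lia.
  apply: (@leq_trans ((2 * N.-1) ^ 12)); first by rewrite leq_exp2r //; lia.
  by rewrite expnMn leq_mul.
have BN : B <= N.
  rewrite -(@leq_exp2r _ _ 12) //; apply: leq_trans hN.
  apply: (@leq_trans ((B ^ 2) ^ 11)); last by rewrite leq_exp2r.
  by rewrite -expnM leq_pexp2l //; lia.
have A0 : 0 < N %/ B by rewrite divn_gt0 //; lia.
have AB : N %/ B * B <= N by rewrite leq_divM.
have lt := ltn_ceil N (ltnW B1).
have /andP[l1 l2] := @trunc_log_bounds 2 p isT (ltnW (ltnW (ltnW p3))).
exists N, (N %/ B), B, (trunc_log 2 p).+1; split => //; try lia; try nia.
by rewrite expnS leq_mul2l.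
Qed.

Lemma F_bound (p N A B L : nat) :
  prime p -> 3 < p -> burgess_params p N A B L ->
  exists2 T, F p <= N + p %/ N * T &
    p * T <= 8 * N ^ 2 \/ T ^ 4 * A * B ^ 2 <= 2 ^ 12 * N ^ 3 * p ^ 2 * L ^ 2.
Proof.
move=> p_pr p3 [_ _ Np A0 B0 AB _ B2 _ A2 _ AL _].
have N0 : 0 < N by rewrite (leq_trans _ AB) // muln_gt0 A0.
exists (\max_(k < p | (0 < k) && (k * N < p)) #|fixed_in_block p N (k * N)|).
  apply: F_le_blocks => // k k0 kN.
  have kp : k < p by apply: leq_ltn_trans kN; apply: leq_pmulr.
  by apply: (bigop.bigmax_sup (Ordinal kp)); rewrite //= k0 kN.
(* The maximum is 0 or one of the block counts, so it inherits the alternative. *)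
elim/big_ind: _ => [||k /andP[k0 kN]]; first by left; rewrite muln0.
  by move=> x y hx hy; rewrite /maxn; case: ifP.
by apply: (@block_bound p N A B); rewrite ?leq_pmull //; lia.
Qed.

End FixedPoints.

(* Real estimates and the final exponent *)
From Stdlib Require Import Reals Lra.
Open Scope R_scope.

Lemma INR_addn (m n : nat) : INR (addn m n) = INR m + INR n.
Proof. by rewrite -plusE plus_INR. Qed.

Lemma INR_muln (m n : nat) : INR (muln m n) = INR m * INR n.
Proof. by rewrite -multE mult_INR. Qed.

Lemma INR_expn (m n : nat) : INR (expn m n) = INR m ^ n.
Proof. by elim: n => [|n IH] //=; rewrite expnS INR_muln IH. Qed.

Lemma INR_leq (m n : nat) : leq m n -> INR m <= INR n.
Proof. by move/leP; apply: le_INR. Qed.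

Lemma pow_le_inv (n : nat) (a b : R) : 0 <= b -> a ^ n.+1 <= b ^ n.+1 -> a <= b.
Proof.
move=> b0 h; case: (Rle_lt_dec a b) => // ba.
have : b ^ n.+1 < a ^ n.+1; last lra.
elim: n {h} => [|n IH]; first by rewrite !pow_1.
rewrite -!(tech_pow_Rmult _ n.+1).
apply: Rle_lt_trans (Rmult_le_compat_r _ _ _ (pow_le _ _ b0) (Rlt_le _ _ ba)) _.
by apply: Rmult_lt_compat_l IH; lra.
Qed.

(** [x] stands for p^(1/12). In the second case n x^6 <= 4 a b^2 leads to t^4 <= 2^16 x^40 l^2; as l
    >= 1, l^2 is enlarged to l^4 so that fourth roots are exact. *)
Lemma block_size_le (x n a b l t : R) :
  1 <= x -> 0 < n -> n <= 2 * x ^ 11 -> n <= 2 * (a * b) -> 0 < b ->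
  x ^ 12 <= 4 * b ^ 2 -> 1 <= l -> 0 <= t ->
  x ^ 12 * t <= 8 * n ^ 2 \/
  t ^ 4 * a * b ^ 2 <= 2 ^ 12 * n ^ 3 * (x ^ 12) ^ 2 * l ^ 2 ->
  t <= 32 * x ^ 10 * l.
Proof.
move=> x1 n0 nx nab b0 xb l1 t0.
have pos k : 0 < x ^ k by apply: pow_lt; lra.
have n2 : n ^ 2 <= 4 * x ^ 22.
  have -> : 4 * x ^ 22 = (2 * x ^ 11) ^ 2 by ring.
  by apply: pow_incr; lra.
have xl : x ^ 10 <= x ^ 10 * l by have := pos 10%nat; nra.
have pxl : 0 < x ^ 10 * l by have := pos 10%nat; nra.
case=> h.
  apply: (Rle_trans _ (32 * x ^ 10)); last lra.
  apply: (Rmult_le_reg_l (x ^ 12)) => //.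
  have -> : x ^ 12 * (32 * x ^ 10) = 8 * (4 * x ^ 22) by ring.
  lra.
apply: (Rle_trans _ (16 * x ^ 10 * l)); last lra.
apply: (@pow_le_inv 3); first lra.
have x6 : x ^ 6 <= 2 * b.
  apply: (@pow_le_inv 1); first lra.
  have -> : (x ^ 6) ^ 2 = x ^ 12 by ring.
  lra.
have t4 : 0 <= t ^ 4 by apply: pow_le.
have nx6 : n * x ^ 6 <= 4 * (a * b ^ 2).
  apply: (Rle_trans _ (2 * (a * b) * (2 * b))); last by right; ring.
  by apply: Rmult_le_compat => //; [lra|left].
have h1 : t ^ 4 * (n * x ^ 6) <= 4 * (2 ^ 12 * n ^ 3 * (x ^ 12) ^ 2 * l ^ 2).
  apply: (Rle_trans _ (t ^ 4 * (4 * (a * b ^ 2)))).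
    by apply: Rmult_le_compat_l.
  lra.
have nx6_gt0 : 0 < n * x ^ 6 by apply: Rmult_lt_0_compat.
apply: (Rmult_le_reg_r (n * x ^ 6)) => //; apply: Rle_trans h1 _.
have l2 : l ^ 2 <= l ^ 4 by apply: Rle_pow => //; apply/leP.
have l20 : 0 <= l ^ 2 by apply: pow_le; lra.
have -> : 4 * (2 ^ 12 * n ^ 3 * (x ^ 12) ^ 2 * l ^ 2) =
  (n ^ 2 * l ^ 2) * (2 ^ 14 * (n * x ^ 24)) by ring.
have -> : (16 * x ^ 10 * l) ^ 4 * (n * x ^ 6) =
  ((4 * x ^ 22) * l ^ 4) * (2 ^ 14 * (n * x ^ 24)) by ring.
apply: Rmult_le_compat_r.
  apply: Rmult_le_pos; first by apply: pow_le; lra.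
  by left; apply: Rmult_lt_0_compat.
by apply: Rmult_le_compat => //; apply: pow_le; lra.
Qed.

(** First L <= 4 ln y. With v = eps ln y / 2, y^eps = exp(v)^2 >= v^2, and this is at least 34 * 4
    ln y once eps^2 ln y >= 544 = 4 * 4 * 34. *)
Lemma log_le_Rpower (eps y : R) (L : nat) : 0 < eps -> 2 <= y ->
  544 / eps ^ 2 <= ln y -> 2 ^ L <= 2 * y -> 34 * INR L <= Rpower y eps.
Proof.
move=> eps0 y2 hy hL.
have ln2y : ln 2 <= ln y by case: y2 => [h|<-]; [left; apply: ln_increasing; lra|lra].
have hl : INR L <= 4 * ln y.
  have : ln (2 ^ L) <= ln (2 * y).
    case: hL => [h|->]; last lra.
    by left; apply: ln_increasing => //; apply: pow_lt; lra.
  rewrite ln_pow ?ln_mult; try lra.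
  have := ln_lt_2; have := pos_INR L; nra.
have e2 : 0 < eps ^ 2 by apply: pow_lt.
have lny : 544 <= eps ^ 2 * ln y.
  have -> : 544 = eps ^ 2 * (544 / eps ^ 2) by field; lra.
  by apply: Rmult_le_compat_l; lra.
have lny0 : 0 < ln y by have := ln_lt_2; lra.
set v := eps * ln y / 2.
have v0 : 0 <= v by rewrite /v; have := Rmult_lt_0_compat _ _ eps0 lny0; lra.
have -> : Rpower y eps = exp v * exp v.
  by rewrite -exp_plus /Rpower /v; congr exp; field.
have ev : v <= exp v by have := exp_ineq1_le v; lra.
apply: (Rle_trans _ (v * v)); last by apply: Rmult_le_compat.
have -> : v * v = (eps ^ 2 * ln y) * ln y / 4 by rewrite /v; field.
nra.
Qed.

Theorem theorem8 :
  forall eps : R, 0 < eps ->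
  exists P : nat, forall p : nat, prime p -> leq P p ->
    INR (F p) <= Rpower (INR p) (11 / 12 + eps).
Proof.
move=> eps eps0.
(* The threshold ensures ln p >= 544 / eps^2 for [log_le_Rpower]. *)
have [P hP] := INR_unbounded (exp (544 / eps ^ 2)).
exists (maxn P 4) => p p_pr; rewrite geq_max => /andP[Pp p4].
have [N [A [B [L bp]]]] := FixedPoints.burgess_params_exist p4.
have [T hF hT] := FixedPoints.F_bound p_pr p4 bp.
case: bp => Nge Nle Np A0 B0 AB NAB B2 pB A2 L0 AL L2.
have p4R : 4 <= INR p by have := INR_leq p4; rewrite /=; lra.
set x := Rpower (INR p) (1 / 12).
have x12 : x ^ 12 = INR p.
  rewrite -Rpower_pow; last exact: exp_pos.
  rewrite Rpower_mult (_ : 1 / 12 * INR 12 = 1) ?Rpower_1 //; first lra.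
  by rewrite /=; field.
have x11 : Rpower (INR p) (11 / 12) = x ^ 11.
  rewrite -Rpower_pow; last exact: exp_pos.
  by rewrite Rpower_mult; congr Rpower; rewrite /=; field.
have x0 : 0 < x by exact: exp_pos.
have x1 : 1 <= x by apply: (@pow_le_inv 11); rewrite ?pow1; lra.
have N0 : 0 <= INR N := pos_INR N.
have Nx : x ^ 11 <= INR N.
  apply: (@pow_le_inv 11) => //; rewrite -pow_mult Nat.mul_comm pow_mult x12.
  by have := INR_leq Nge; rewrite !INR_expn.
have N2x : INR N <= 2 * x ^ 11.
  have x11_gt0 : 0 < x ^ 11 by apply: pow_lt.
  apply: (@pow_le_inv 11); first lra.
  rewrite Rpow_mult_distr -(pow_mult x) Nat.mul_comm pow_mult x12.
  by have := INR_leq Nle; rewrite !(INR_expn, INR_muln).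
have xpos k : 0 < x ^ k by apply: pow_lt.
have Npos : 0 < INR N by have := xpos 11%nat; lra.
have B1 : 1 <= INR B by have := INR_leq B0; rewrite /=; lra.
have L1 : 1 <= INR L by have := INR_leq L0; rewrite /=; lra.
have hTx : INR T <= 32 * x ^ 10 * INR L.
  apply: (@block_size_le x (INR N) (INR A) (INR B)) => //.
  - by have := INR_leq NAB; rewrite !INR_muln.
  - lra.
  - have := INR_leq pB; rewrite !(INR_expn, INR_muln) x12 (_ : INR 4 = 4) //=; lra.
  - exact: pos_INR.
  case: hT => /INR_leq hT; [left | right]; move: hT; rewrite x12.
    by rewrite !(INR_expn, INR_muln) (_ : INR 8 = 8) //=; lra.
  by rewrite !(INR_expn, INR_muln).
have divx : INR (p %/ N) <= x.
  apply: (Rmult_le_reg_r (x ^ 11)) => //.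
  apply: (Rle_trans _ (INR (p %/ N) * INR N)).
    by apply: Rmult_le_compat_l => //; apply: pos_INR.
  have -> : x * x ^ 11 = INR p by rewrite -x12; ring.
  by rewrite -INR_muln; apply: INR_leq; apply: leq_divM.
(* 34 = 2 + 32, from N <= 2 x^11, p / N <= x and T <= 32 x^10 L, with L >= 1. *)
have F34 : INR (F p) <= x ^ 11 * (34 * INR L).
  apply: (Rle_trans _ (2 * x ^ 11 + x * (32 * x ^ 10 * INR L))).
    have := INR_leq hF; rewrite INR_addn INR_muln.
    have := Rmult_le_compat _ _ _ _ (pos_INR (p %/ N)) (pos_INR T) divx hTx.
    lra.
  have := xpos 11%nat; have -> : x * (32 * x ^ 10 * INR L) = 32 * x ^ 11 * INR L by ring.
  nra.
rewrite Rpower_plus x11; apply: (Rle_trans _ _ _ F34).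
apply: Rmult_le_compat_l; first by left.
apply: log_le_Rpower => //; first lra.
  have e0 := exp_pos (544 / eps ^ 2).
  rewrite -[X in X <= _]ln_exp; left; apply: ln_increasing => //.
  by have := INR_leq Pp; lra.
by have := INR_leq L2; rewrite !(INR_expn, INR_muln).
Qed.
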